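(* Let $\lambda\vdash n$ be an arbitrary Young diagram. Then the representation of $\mathfrak S_n$ in the space of forms $L_\lambda$, acting by permutations of the variables $x_1,\dots,x_n$, is equivalent to the induced representation $\Pi_\lambda=\mathrm{Ind}_{H(\lambda)}^{\mathfrak S_n}\mathbf 1$.
   Context: $\lambda$ has row lengths $\lambda_1\ge\lambda_2\ge\dots\ge\lambda_k>0$, $\sum_i\lambda_i=n$; $H(\lambda)\cong\mathfrak S_{\lambda_1}\times\cdots\times\mathfrak S_{\lambda_k}$ is the Young subgroup of $\mathfrak S_n$ preserving the rows of a fixed filling of $\lambda$ by $1,\dots,n$, and $\mathbf 1$ is its identity representation (over $\mathbb C$). Put $n'=n-\lambda_1$, the number of cells in the rows of $\lambda$ starting from the second one. For $n'$ variables $y_{i,j}$ indexed by the cells $(i,j)$ of $\lambda$ ($i$ = row, $j$ = column) with $i>1$, consider the monomial $X_\lambda(\{y_{i,j}\})=\prod_{(i,j),\,i>1}y_{i,j}^{\,i-1}$ (equal to $1$ if $n'=0$). $L_\lambda$ is the complex linear span, inside the polynomial ring $\mathbb C[x_1,\dots,x_n]$ in commuting variables, of all monomials obtained from $X_\lambda$ by substituting for the $y_{i,j}$ any $n'$ distinct variables chosen from $x_1,\dots,x_n$ (in any assignment). $L_\lambda$ is invariant under the action of $\mathfrak S_n$ by permutation of the variables. *)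

(* Defs.v *)
From HB Require Import structures.
From mathcomp Require Import all_boot all_order all_algebra all_fingroup.
From mathcomp Require Import boolp reals complex mpoly.

Set Implicit Arguments.
Unset Strict Implicit.
Unset Printing Implicit Defensive.

Import GRing.Theory.
Local Open Scope ring_scope.

Section Representations.
Variable F : fieldType.

Record rep (gT : finGroupType) := Rep {
  rep_mod :> lmodType F;
  rep_fun : gT -> {linear rep_mod -> rep_mod};
  rep_fun1 : forall v, rep_fun 1%g v = v;
  rep_funM : forall g h v, rep_fun (g * h)%g v = rep_fun g (rep_fun h v) }.

Definition rep_equiv (gT : finGroupType) (U V : rep gT) : Prop :=
  exists f : {linear U -> V},
    bijective f /\ forall g u, f (rep_fun U g u) = rep_fun V g (f u).

Section Trivial.
Variable gT : finGroupType.

Definition triv_fun (_ : gT) : {linear F^o -> F^o} := idfun.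

Definition triv_rep : rep gT :=
  @Rep gT F^o triv_fun (fun=> erefl) (fun _ _ _ => erefl).
End Trivial.

Section Submodule.
Variables (V : lmodType F) (S : submodClosed V).

Record submod := Submod { submod_val : V; submod_valP : submod_val \in S }.

HB.instance Definition _ := [isSub for submod_val].
HB.instance Definition _ := [Choice of submod by <:].
HB.instance Definition _ := [SubChoice_isSubLmodule of submod by <:].
End Submodule.

Section Subrepresentation.
Variables (gT : finGroupType) (V : rep gT) (S : submodClosed V).
Hypothesis S_stable : forall g v, v \in S -> rep_fun V g v \in S.

Definition subrep_act (g : gT) (u : submod S) : submod S :=
  Submod (S_stable g (submod_valP u)).

Fact subrep_act_linear g : linear (subrep_act g).
Proof. by move=> a u v; apply: val_inj; rewrite /= !linearP. Qed.

HB.instance Definition _ g :=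
  GRing.isLinear.Build F (submod S) (submod S) *:%R (subrep_act g)
    (subrep_act_linear g).

Definition subrep_fun (g : gT) : {linear submod S -> submod S} := subrep_act g.

Fact subrep_fun1 u : subrep_fun 1%g u = u.
Proof. by apply: val_inj; rewrite /= rep_fun1. Qed.

Fact subrep_funM g h u : subrep_fun (g * h)%g u = subrep_fun g (subrep_fun h u).
Proof. by apply: val_inj; rewrite /= rep_funM. Qed.

Definition subrep : rep gT := Rep subrep_fun1 subrep_funM.
End Subrepresentation.

Section Induction.
Variables (gT : finGroupType) (H : {group gT}) (W : rep (subg_of H)).

Definition transl_act (g : gT) (f : {ffun gT -> W}) : {ffun gT -> W} :=
  [ffun x => f (x * g)%g].

Fact transl_act_linear g : linear (transl_act g).
Proof. by move=> a u v; apply/ffunP=> x; rewrite !ffunE. Qed.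

HB.instance Definition _ g :=
  GRing.isLinear.Build F {ffun gT -> W} {ffun gT -> W} *:%R (transl_act g)
    (transl_act_linear g).

Definition transl_fun (g : gT) : {linear {ffun gT -> W} -> {ffun gT -> W}} :=
  transl_act g.

Fact transl_fun1 f : transl_fun 1%g f = f.
Proof. by apply/ffunP=> x; rewrite ffunE mulg1. Qed.

Fact transl_funM g h f : transl_fun (g * h)%g f = transl_fun g (transl_fun h f).
Proof. by apply/ffunP=> x; rewrite !ffunE mulgA. Qed.

Definition transl_rep : rep gT := Rep transl_fun1 transl_funM.

Definition ind_pred : {pred transl_rep} :=
  fun f : {ffun gT -> W} =>
    [forall h : subg_of H, forall x, f (sgval h * x)%g == rep_fun W h (f x)].

Fact ind_pred_submod : submod_closed ind_pred.
Proof.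
split=> [|a u v /forallP uP /forallP vP]; apply/forallP=> h; apply/forallP=> x.
  by rewrite !ffunE linear0.
by rewrite !ffunE linearP (eqP (forallP (uP h) x)) (eqP (forallP (vP h) x)).
Qed.

HB.instance Definition _ :=
  GRing.isSubmodClosed.Build F transl_rep ind_pred ind_pred_submod.

Fact ind_pred_stable g f : f \in ind_pred -> rep_fun transl_rep g f \in ind_pred.
Proof.
move=> /forallP fP; apply/forallP=> h; apply/forallP=> x.
by rewrite !ffunE -mulgA (eqP (forallP (fP h) _)).
Qed.

(* The induced representation, in its model of W-valued functions f on the
   group such that f (h x) = h . f x for h in H, with (g . f) x = f (x g). *)
Definition ind_rep : rep gT := subrep ind_pred_stable.
End Induction.

Section Span.
Variables (V : lmodType F) (I : finType) (P : pred I) (b : I -> V).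

Definition span_pred : {pred V} :=
  fun v => `[< exists c : I -> F, v = \sum_(i | P i) c i *: b i >].

Fact span_pred_submod : submod_closed span_pred.
Proof.
split=> [|a _ _ /asboolP[c ->] /asboolP[d ->]]; apply/asboolP.
  by exists (fun=> 0); rewrite big1 // => i _; rewrite scale0r.
exists (fun i => a * c i + d i).
rewrite scaler_sumr -big_split /=; apply: eq_bigr => i _.
by rewrite scalerDl scalerA.
Qed.

HB.instance Definition _ :=
  GRing.isSubmodClosed.Build F V span_pred span_pred_submod.

Fact mem_span_pred i : P i -> b i \in span_pred.
Proof.
move=> Pi; apply/asboolP; exists (fun j => (j == i)%:R).
rewrite (bigD1 i) //= eqxx scale1r big1 ?addr0 // => j /andP[_ /negPf->].
by rewrite scale0r.
Qed.
End Span.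

Section PolynomialAction.
Variable n : nat.

(* Products of permutations are read from left to right, (s * t) i = t (s i),
   so that the substitutions x_i |-> x_(s i), i.e., msym s, compose as a right
   action; the inverse turns them into a left action. *)
Definition perm_poly_fun (s : 'S_n) : {linear {mpoly F[n]} -> {mpoly F[n]}} :=
  msym s^-1%g.

Fact perm_poly_fun1 p : perm_poly_fun 1%g p = p.
Proof. by rewrite /perm_poly_fun /= invg1 msym1m. Qed.

Fact perm_poly_funM s t p :
  perm_poly_fun (s * t)%g p = perm_poly_fun s (perm_poly_fun t p).
Proof. by rewrite /perm_poly_fun /= invMg msymMm. Qed.

Definition perm_poly_rep : rep 'S_n := Rep perm_poly_fun1 perm_poly_funM.
End PolynomialAction.

End Representations.

Definition is_partition (n : nat) (lam : seq nat) : Prop :=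
  [/\ sorted geq lam, 0%N \notin lam & sumn lam = n].

(* Rows and columns are numbered from 0: the cell Tagged _ j of row i stands
   for the cell (i + 1, j + 1) of the diagram. *)
Definition cell (lam : seq nat) := {i : 'I_(size lam) & 'I_(nth 0%N lam i)}.

Definition cell_row (lam : seq nat) (c : cell lam) : 'I_(size lam) := tag c.

Definition young_subgroup (n : nat) (lam : seq nat) (T : cell lam -> 'I_n) :
    {group 'S_n} :=
  (\bigcap_(i < size lam) 'N([set T c | c : cell lam & cell_row c == i] | 'P))%G.

Definition low_cell (lam : seq nat) := {c : cell lam | (0 < cell_row c)%N}.

Definition X_mon (lam : seq nat) (A : comNzRingType)
    (y : low_cell lam -> A) : A :=
  \prod_(c : low_cell lam) y c ^+ cell_row (val c).

Section SpaceOfForms.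
Variables (F : fieldType) (n : nat) (lam : seq nat).

Definition L_gen (y : {ffun low_cell lam -> 'I_n}) : perm_poly_rep F n :=
  X_mon (fun c => 'X_(y c) : {mpoly F[n]}).

Definition L_space : {pred perm_poly_rep F n} :=
  span_pred (fun y : {ffun low_cell lam -> 'I_n} => injectiveb y) L_gen.

HB.instance Definition _ := GRing.SubmodClosed.on L_space.

Fact L_space_stable s p : p \in L_space -> rep_fun (perm_poly_rep F n) s p \in L_space.
Proof.
move=> /asboolP[c ->]; rewrite linear_sum /=; apply: rpred_sum => y y_inj.
rewrite linearZ; apply: rpredZ; rewrite /= rmorph_prod /=.
rewrite (_ : \prod_(d : low_cell lam) _ = L_gen [ffun d => s^-1%g (y d)]).
  apply: mem_span_pred; apply/injectiveP=> d e; rewrite !ffunE.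
  by move=> /perm_inj /(injectiveP _ y_inj).
apply: eq_bigr => d _; rewrite rmorphXn /= ffunE; congr (_ ^+ _).
by rewrite /msym mmapX mmap1U.
Qed.

Definition L_rep : rep F 'S_n := subrep L_space_stable.
End SpaceOfForms.

(* Main.v *)
Require Import Defs.
From HB Require Import structures.
From mathcomp Require Import all_boot all_order all_algebra all_fingroup.
From mathcomp Require Import primitive_action alt.
From mathcomp Require Import boolp reals complex mpoly.

(** Let X be the monomial in which the variable sitting in the cell c of the
filling T has as exponent the row of c (rows counted from 0).  A permutation
fixes X exactly when it preserves every set of variables with a given
exponent, that is, every row of T; so the stabiliser of X is the Young subgroup
H ([perm_row_mnm]).  Any two injections of the low cells into the variables
differ by a permutation of the variables, so the spanning monomials of L are
exactly the translates of X ([L_gen_orbit]), and distinct monomials are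
linearly independent.  Thus L is the permutation module on the orbit of X,
which is the representation induced from the trivial one of the stabiliser.

The last step is [transitive_module_ind].  It is proved by Frobenius
reciprocity: the coefficient of X is an H-invariant linear form l on L, hence
u |-> (x |-> l (x u)) is an equivariant map from L to the induced
representation.  Its inverse sends f to the sum of f(x) x^-1 X over the right
cosets H x.  Summing over cosets, instead of averaging over the group, makes
the argument valid over any field. *)

Set Implicit Arguments.
Unset Strict Implicit.
Unset Printing Implicit Defensive.

Import GRing.Theory.
Local Open Scope ring_scope.

(** * Modules generated by one orbit *)

(** The only right coset of H that contributes is that of x, and w cannot tell
its representative from x. *)
Lemma sum_rcosets_repr (gT : finGroupType) (H : {group gT}) (F : fieldType)
    (V : lmodType F) (w : gT -> V) (x : gT) :
  (forall h y, h \in H -> w (h * y)%g = w y) ->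
  \sum_(C in rcosets H [set: gT])
    (x * (repr C)^-1 \in H)%g%:R *: w (repr C) = w x.
Proof.
move=> wH.
have in_cosets : (H :* x)%g \in rcosets H [set: gT].
  by apply/rcosetsP; exists x; rewrite ?inE.
rewrite (bigD1 (H :* x)%g) //= big1 => [|_ /andP[/rcosetsP[y _ ->] neq]].
  rewrite addr0; have /rcosetP[h hH ->] := mem_repr_rcoset H x.
  by rewrite invMg mulKVg groupV hH scale1r wH.
(* The representative of H y is some h y, and x (h y)^-1 lies in H only if
   H x = H y. *)
rewrite -mem_rcoset (rcoset_eqP (mem_repr_rcoset H y)).
case: rcoset_eqP => [eq_yx|_]; last by rewrite scale0r.
by rewrite eq_yx eqxx in neq.
Qed.

(** The properties of l encode both that the stabiliser of v is no larger than H
and that the distinct translates of v are linearly independent: l is the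
coefficient of v itself. *)
Section TransitiveModule.
Variables (F : fieldType) (gT : finGroupType) (H : {group gT}).
Variables (U : rep F gT) (v : U) (l : {scalar U}).
Hypothesis v_fixed : forall h, h \in H -> rep_fun U h v = v.
Hypothesis l_transl : forall g, l (rep_fun U g v) = (g \in H)%:R.
Hypothesis v_gen :
  forall u, exists (I : finType) (c : I -> F) (g : I -> gT),
    u = \sum_i c i *: rep_fun U (g i) v.

Let W := triv_rep F (subg_of H).

(** On a translate of v this says that h g is in H exactly when g is. *)
Lemma scalar_invariant h u : h \in H -> l (rep_fun U h u) = l u.
Proof.
move=> hH; have [I [c [g ->]]] := v_gen u.
rewrite !linear_sum; apply: eq_bigr => i _.
by rewrite !linearZ /= -rep_funM !l_transl groupMl.
Qed.

Definition scalar_orbit (u : U) : transl_rep W :=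
  [ffun x => l (rep_fun U x u)].

Lemma scalar_orbit_ind u : scalar_orbit u \in ind_pred (W := W).
Proof.
apply/forallP=> h; apply/forallP=> x.
by rewrite !ffunE rep_funM scalar_invariant ?subgP.
Qed.

Definition to_ind (u : U) : ind_rep W := Submod (scalar_orbit_ind u).

Lemma to_ind_linear : linear to_ind.
Proof.
by move=> a u1 u2; apply: val_inj; apply/ffunP=> x; rewrite !ffunE !linearP.
Qed.

HB.instance Definition _ :=
  GRing.isLinear.Build F U (ind_rep W) *:%R to_ind to_ind_linear.

Definition of_ind (f : ind_rep W) : U :=
  \sum_(C in rcosets H [set: gT])
    (submod_val f : {ffun gT -> F^o}) (repr C) *: rep_fun U (repr C)^-1%g v.

(** Both composites reduce to [sum_rcosets_repr]: here with w x = x^-1 v, which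
is constant on right cosets as H fixes v; in [of_indK] with w = f, which is
constant on right cosets by definition of the induced module. *)
Lemma to_indK : cancel to_ind of_ind.
Proof.
move=> u; have [I [c [g ->]]] := v_gen u; rewrite /of_ind /=.
under eq_bigr => C _ do
  rewrite ffunE !linear_sum scaler_suml; rewrite exchange_big /=.
apply: eq_bigr => i _.
under eq_bigr => C _ do
  rewrite !linearZ /= -rep_funM l_transl -scalerA -groupV invMg.
rewrite -scaler_sumr.
rewrite (sum_rcosets_repr (w := fun x => rep_fun U x^-1%g v)) ?invgK //.
by move=> h y hH; rewrite invMg rep_funM v_fixed ?groupV.
Qed.

Lemma of_indK : cancel of_ind to_ind.
Proof.
move=> f; apply: val_inj; apply/ffunP=> x; rewrite /= ffunE.
have /forallP fP := submod_valP f.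
rewrite /of_ind !linear_sum /=.
under eq_bigr => C _ do rewrite !linearZ /= -rep_funM l_transl mulrC.
apply: (sum_rcosets_repr (V := F^o)
         (w := (submod_val f : {ffun gT -> F^o}))) => h y hH.
by have /forallP/(_ y)/eqP := fP (subg H h); rewrite subgK.
Qed.

Lemma transitive_module_ind : rep_equiv U (ind_rep W).
Proof.
exists to_ind; split; first exact: Bijective to_indK of_indK.
by move=> g u; apply: val_inj; apply/ffunP=> x; rewrite !ffunE rep_funM.
Qed.

End TransitiveModule.

(** * Forms spanned by the monomials *)

(** This is the #|I|-fold transitivity of the symmetric group on X, applied to
the tuples of values of f and g. *)
Lemma inj_perm_ext (I X : finType) (f g : I -> X) :
  injective f -> injective g -> exists s : {perm X}, forall i, s (f i) = g i.
Proof.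
move=> f_inj g_inj.
pose t h : #|I|.-tuple X := [tuple h (enum_val i) | i < #|I|].
have t_on h : injective h -> t h \in #|I|.-dtuple([set: X]).
  move=> h_inj; apply/dtuple_onP; split=> [i j|i]; last by rewrite inE.
  by rewrite !tnth_mktuple => /h_inj/enum_val_inj.
have leIX : (#|I| <= #|X|)%N by rewrite -(card_codom f_inj) max_card.
have tr := ntransitive_weak leIX (Sym_trans X).
have [s _ ts] := atransP2 tr (t_on f f_inj) (t_on g g_inj).
exists s => i; have := congr1 (fun u => tnth u (enum_rank i)) ts.
by rewrite tnth_mktuple [RHS]tnth_map tnth_mktuple enum_rankK => ->.
Qed.

Section Forms.
Variables (F : fieldType) (n : nat) (lam : seq nat) (T : cell lam -> 'I_n).
Hypothesis T_bij : bijective T.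

Let T_inj : injective T := bij_inj T_bij.

Definition low_filling : {ffun low_cell lam -> 'I_n} := [ffun c => T (val c)].

Lemma low_filling_inj : injective low_filling.
Proof. by move=> c d; rewrite !ffunE => /T_inj/val_inj. Qed.

Definition row_mnm : 'X_{1..n} :=
  (\sum_(c : low_cell lam) U_(low_filling c) *+ cell_row (val c))%MM.

Lemma L_gen_filling : L_gen F low_filling = 'X_[row_mnm].
Proof. by rewrite /L_gen /X_mon mprodXnE. Qed.

(** The cells of row 0, which do not occur in the product defining the monomial,
get the exponent 0, so that the formula holds for all cells. *)
Lemma row_mnmE c : row_mnm (T c) = cell_row c.
Proof.
rewrite /row_mnm mnm_sumE.
under eq_bigr => d _ do rewrite mulmnE mnm1E ffunE (inj_eq T_inj).
have [row0|row_gt0] := posnP (cell_row c).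
  rewrite row0 big1 // => d _; case: eqP => [dc|]; rewrite ?mul0n //.
  by have := valP d; rewrite /= dc row0.
pose d : low_cell lam := Sub c row_gt0.
rewrite (bigD1 d) //= eqxx mul1n big1 ?addn0 // => e.
by rewrite -val_eqE /= => /negPf->.
Qed.

(** The rows of the filling are the level sets of the exponent function, because
cells in distinct rows have distinct exponents. *)
Lemma young_subgroupP (s : 'S_n) :
  reflect (forall i, row_mnm (s i) = row_mnm i) (s \in young_subgroup T).
Proof.
have T_surj j : exists c, j = T c.
  by have [T' _ T'K] := T_bij; exists (T' j); rewrite T'K.
have rowE i j : (j \in [set T c | c : cell lam & cell_row c == i])
    = (row_mnm j == i :> nat).
  apply/imsetP/eqP => [[c /[!inE] /eqP <- ->]|]; first exact: row_mnmE.
  have [c ->] := T_surj j; rewrite row_mnmE => /val_inj row_c.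
  by exists c; rewrite ?inE ?row_c.
apply: (iffP bigcapP) => [sH j | sP i _].
  have [c ->] := T_surj j.
  have /astabsP/(_ (T c)) := sH (cell_row c) isT.
  by rewrite !rowE row_mnmE eqxx /= /aperm => /eqP.
by apply/astabsP=> j; rewrite !rowE /= /aperm sP.
Qed.

Lemma perm_L_gen s (y : {ffun low_cell lam -> 'I_n}) :
  rep_fun (perm_poly_rep F n) s (L_gen F y) = L_gen F [ffun d => s^-1%g (y d)].
Proof.
rewrite /= rmorph_prod; apply: eq_bigr => d _.
by rewrite rmorphXn /= ffunE /msym mmapX mmap1U.
Qed.

Lemma perm_row_mnm (s : 'S_n) :
  s \in young_subgroup T = ([multinom row_mnm (s i) | i < n] == row_mnm).
Proof.
apply/young_subgroupP/eqP=> [sP|/mnmP sP i].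
  by apply/mnmP=> i; rewrite mnmE.
by have := sP i; rewrite mnmE.
Qed.

Lemma L_gen_filling_mem : L_gen F low_filling \in L_space lam.
Proof. by apply: mem_span_pred; apply/injectiveP/low_filling_inj. Qed.

Definition filling_form : L_rep F n lam := Submod L_gen_filling_mem.

Definition row_coef (u : L_rep F n lam) : F :=
  (submod_val u : {mpoly F[n]})@_row_mnm.

Lemma row_coef_linear : scalar row_coef.
Proof. by move=> a u v; rewrite /row_coef /= mcoeffD mcoeffZ. Qed.

HB.instance Definition _ :=
  GRing.isLinear.Build F (L_rep F n lam) F *%R row_coef row_coef_linear.

(** The inverse in the action on polynomials cancels the one in the effect of a
substitution on exponents. *)
Lemma perm_filling_form s :
  submod_val (rep_fun (L_rep F n lam) s filling_form)
  = 'X_[[multinom row_mnm (s i) | i < n]].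
Proof. by rewrite /= L_gen_filling msymX invgK. Qed.

Lemma L_gen_orbit (y : {ffun low_cell lam -> 'I_n}) :
  injective y ->
  exists s, L_gen F y = rep_fun (perm_poly_rep F n) s (L_gen F low_filling).
Proof.
move=> y_inj; have [s sE] := inj_perm_ext low_filling_inj y_inj.
exists s^-1%g; rewrite perm_L_gen invgK; congr (L_gen _ _).
by apply/ffunP=> d; rewrite ffunE sE.
Qed.

Lemma L_rep_ind :
  rep_equiv (L_rep F n lam)
    (ind_rep (triv_rep F (subg_of (young_subgroup T)))).
Proof.
apply: (@transitive_module_ind _ _ _ _ filling_form row_coef) => [s|s|u].
- rewrite perm_row_mnm => /eqP sP; apply: val_inj.
  by rewrite [LHS]perm_filling_form sP -L_gen_filling.
- by rewrite perm_row_mnm -mcoeffX -perm_filling_form.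
have /asboolP[c u_c] := submod_valP u.
have orbit (y : {ffun low_cell lam -> 'I_n}) : exists s, injectiveb y ->
    L_gen F y = rep_fun (perm_poly_rep F n) s (L_gen F low_filling).
  have [/injectiveP/L_gen_orbit[s ys]|_] := boolP (injectiveb y).
    by exists s.
  by exists 1%g.
have [s sE] := choice orbit.
(* The non-injective fillings, which do not occur in the sum defining u, get
   the coefficient 0. *)
exists {ffun low_cell lam -> 'I_n},
  (fun y : {ffun low_cell lam -> 'I_n} => c y *+ injectiveb y), s.
apply: val_inj; rewrite [LHS]u_c raddf_sum big_mkcond.
apply: eq_bigr => y _; rewrite /=; case: ifP => [/sE -> //|_].
by rewrite mulr0n scale0r.
Qed.

End Forms.

Theorem proposition2 (R : realType) (n : nat) (lam : seq nat)
    (lam_part : is_partition n lam)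
    (T : cell lam -> 'I_n) (T_bij : bijective T) :
  rep_equiv (L_rep R[i] n lam)
    (ind_rep (triv_rep R[i] (subg_of (young_subgroup T)))).
Proof. exact: L_rep_ind. Qed.
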